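(* Let $(X_t)_{t\in\mathbb{Z}}$ be a regularly varying, strictly stationary time series with tail process $(Y_t)_{t\in\mathbb{Z}}$ whose finite-dimensional distributions are given by $(\mu_I)_{I\subset\mathbb{Z}}$. Assume that its $\alpha$-mixing coefficients satisfy $\alpha_n\in\mathcal{O}(n^{-\delta})$ for some $\delta>1$. Let $t\in\mathbb{N}_0$ and let $A_0,A_1\subset[0,\infty)\times(1,\infty)\times[0,\infty)^t$ be continuity sets with respect to $\mu_{\{-1,\ldots,t\}}$ such that $\mu_{\{-1,\ldots,t\}}(A_0)>0$. Then, for any sequence $(u_n)_{n\in\mathbb{N}}$ satisfying $u_n\to\infty$ and $$n^{\delta/(1+\delta)}\,\mathbb{P}(X_0>u_n)\to\infty,$$ we have, as $n\to\infty$, $$\widehat{R}_{n,u_n}(A_1,A_0)\longrightarrow\frac{\mu_{\{-1,\ldots,t\}}(A_1)}{\mu_{\{-1,\ldots,t\}}(A_0)}\quad\text{in probability}.$$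
   Context: Standing assumptions: the time series $(X_t)_{t\in\mathbb{Z}}$ is strictly stationary, its marginal distribution function has a finite lower endpoint and lies in the max-domain of attraction of the $\alpha$-Fréchet distribution $\Phi_\alpha(x)=\exp(-x^{-\alpha})$, $x>0$, for some $\alpha>0$. A random vector $\mathbf{X}$ in $\mathbb{R}^d$ is multivariate regularly varying with index $\alpha>0$ if for some norm $\|\cdot\|$ there is a probability measure $\sigma$ on $\{\mathbf{x}\in[0,\infty)^d:\|\mathbf{x}\|=1\}$ such that, for $r>0$, $\mathbb{P}(\|\mathbf{X}\|>rx,\ \mathbf{X}/\|\mathbf{X}\|\in\cdot)/\mathbb{P}(\|\mathbf{X}\|>x)$ converges weakly to $r^{-\alpha}\sigma(\cdot)$ as $x\to\infty$. The time series is regularly varying if all its finite-dimensional margins are multivariate regularly varying; equivalently, there is a process $Y=(Y_t)_{t\in\mathbb{Z}}$, called the tail process, with $\mathbb{P}(Y_0>y)=y^{-\alpha}$ for $y\ge1$ such that for all integers $s<t$ the conditional law of $(X_s/x,\ldots,X_t/x)$ given $X_0>x$ converges weakly to the law of $(Y_s,\ldots,Y_t)$ as $x\to\infty$. For $I\subset\mathbb{Z}$, $\mu_I$ is the law of $(Y_i)_{i\in I}$. A Borel set $A$ is a continuity set with respect to $\mu_{\{-1,\ldots,t\}}$ if $\mu_{\{-1,\ldots,t\}}(\partial A)=0$, with $\partial A$ the topological boundary in $\mathbb{R}^{t+2}$. The $\alpha$-mixing coefficients are $$\alpha_h=\sup_{A,B\in\mathcal{B}(\mathbb{R}^{\mathbb{N}})}\big|\mathbb{P}((X_s)_{s\le0}\in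 A,\,(X_s)_{s\ge h}\in B)-\mathbb{P}((X_s)_{s\le0}\in A)\,\mathbb{P}((X_s)_{s\ge h}\in B)\big|,\quad h\ge0.$$ Based on observations $X_{-1},\ldots,X_n$ and a threshold $u$, the estimators are $$\widehat{P}_{n,u}(A)=\frac1n\sum_{k=1}^{n-t}\mathbf{1}_{\{(X_i)_{i=k-1}^{k+t}\in uA\}},\qquad\widehat{R}_{n,u}(A,A_0)=\frac{\widehat{P}_{n,u}(A)}{\widehat{P}_{n,u}(A_0)},$$ where $uA=\{ua:a\in A\}$ (the ratio is given an arbitrary fixed value when its denominator vanishes). *)

(* Defs.v *)
From HB Require Import structures.
From mathcomp Require Import all_boot all_order all_algebra.
From mathcomp Require Import all_classical all_reals all_analysis.
Set Implicit Arguments.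
Unset Strict Implicit.
Unset Printing Implicit Defensive.
Import Order.TTheory GRing.Theory Num.Theory.
Import numFieldNormedType.Exports.
Local Open Scope classical_set_scope.
Local Open Scope ring_scope.

Definition borel (T : topologicalType) : set (set T) := <<s @open T >>.

(* A finite Borel measure nu on R^k is represented by f |-> \int f dnu, and
   weak convergence is tested on bounded continuous functions. *)
Definition weak_cvg (R : realType) (k : nat)
    (E : R -> ('rV[R]_k -> R) -> R) (L : ('rV[R]_k -> R) -> R) : Prop :=
  forall f : 'rV[R]_k -> R, continuous f -> bounded_fun f ->
    E x f @[x --> +oo] --> L f.

Definition is_norm (R : realType) (k : nat) (N : 'rV[R]_k -> R) : Prop :=
  [/\ forall x, N x = 0 -> x = 0,
      forall a x, N (a *: x) = `|a| * N x &
      forall x y, N (x + y) <= N x + N y].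

(* sigma is a probability on R^(k+1) carried by the part of the unit sphere
   lying in the nonnegative orthant. *)
Definition multivariate_regularly_varying (R : realType) (dT : measure_display)
    (T : measurableType dT) (P : probability T R) (k : nat)
    (V : T -> 'rV[R]_k.+1) (alpha : R) : Prop :=
  exists (N : 'rV[R]_k.+1 -> R)
         (sigma : probability (g_sigma_algebraType (@open 'rV[R]_k.+1)) R),
    [/\ is_norm N,
        sigma [set v : 'rV[R]_k.+1 |
                (forall i, 0 <= v ord0 i) /\ N v = 1] = 1%E &
        forall r : R, 0 < r ->
          weak_cvg
            (fun x f =>
               (\int[P]_(w in [set w | (r * x < N (V w))%R])
                  f ((N (V w))^-1 *: V w)) /
               fine (P [set w | x < N (V w)]))
            (fun f => r `^ (- alpha) * \int[sigma]_v f v)].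

Section Process.
Context (R : realType) (dT : measure_display) (T : measurableType dT)
        (P : probability T R).
Implicit Types (X : int -> {RV P >-> R}) (k h t n : nat) (s : int).

Definition margin X k (tau : 'I_k -> int) (w : T) : 'rV[R]_k :=
  \row_i X (tau i) w.

(* (X_s, X_(s+1), ..., X_(s+k-1)) *)
Definition window X s k : T -> 'rV[R]_k :=
  margin X (fun i : 'I_k => s + (i : nat)%:Z).

Definition law k (V : T -> 'rV[R]_k) (A : set 'rV[R]_k) : \bar R :=
  P (V @^-1` A).

Definition strictly_stationary X : Prop :=
  forall k (tau : 'I_k -> int) s (A : set 'rV[R]_k), borel A ->
    law (margin X (fun i => tau i + s)) A = law (margin X tau) A.

Definition finite_lower_endpoint (Z : {RV P >-> R}) : Prop :=
  ereal_inf [set r%:E | r in [set r | (0 < cdf Z r)%E]] \is a fin_num.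

Definition frechet_cdf (alpha x : R) : R :=
  if 0 < x then expR (- (x `^ (- alpha))) else 0.

Definition in_frechet_domain_of_attraction (Z : {RV P >-> R}) (alpha : R) :
    Prop :=
  exists a b : R^nat, (forall n, 0 < a n) /\
    forall x : R,
      (fine (cdf Z (a n * x + b n)) ^+ n) @[n --> \oo] --> frechet_cdf alpha x.

Definition regularly_varying X (alpha : R) : Prop :=
  forall k (tau : 'I_k.+1 -> int), injective tau ->
    multivariate_regularly_varying P (margin X tau) alpha.

(* The coordinate sequences run backwards from time 0 and forwards from
   time h. *)
Definition past X (w : T) : prod_topology (fun _ : nat => R) :=
  fun i => X (- i%:Z) w.

Definition future X h (w : T) : prod_topology (fun _ : nat => R) :=
  fun i => X (h%:Z + i%:Z) w.

Definition alpha_mixing X h : \bar R :=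
  ereal_sup [set z | exists A B : set (prod_topology (fun _ : nat => R)),
    [/\ borel A, borel B &
        z = `| P (past X @^-1` A `&` future X h @^-1` B)
               - P (past X @^-1` A) * P (future X h @^-1` B) |%E]].

Definition alpha_mixing_bigO X (delta : R) : Prop :=
  exists C : R, \forall n \near \oo,
    (alpha_mixing X n <= (C * n%:R `^ (- delta))%:E)%E.

Definition Phat X t n (u : R) (A : set 'rV[R]_t.+2) (w : T) : R :=
  n%:R^-1 * \sum_(1 <= k < (n - t).+1)
    \1_([set u *: a | a in A]) (window X (k%:Z - 1) t.+2 w).

(* c is the conventional value of the ratio when its denominator vanishes. *)
Definition Rhat (c : R) X t n (u : R) (A A0 : set 'rV[R]_t.+2) (w : T) : R :=
  if Phat X n u A0 w == 0 then c else Phat X n u A w / Phat X n u A0 w.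

Definition cvg_in_probability (Z : nat -> T -> R) (l : R) : Prop :=
  forall eps : R, 0 < eps ->
    P [set w | eps < `|Z n w - l|] @[n --> \oo] --> 0%E.

End Process.

Definition tail_process (R : realType) (dT dS : measure_display)
    (T : measurableType dT) (S : measurableType dS)
    (P : probability T R) (Q : probability S R)
    (X : int -> {RV P >-> R}) (Y : int -> {RV Q >-> R}) (alpha : R) : Prop :=
  (forall y : R, 1 <= y -> Q [set w | y < Y 0 w] = (y `^ (- alpha))%:E) /\
  forall s t : int, s < t ->
    weak_cvg
      (fun x f =>
         (\int[P]_(w in [set w | (x < X 0 w)%R])
            f (x^-1 *: window X s `|t - s|%N.+1 w)) /
         fine (P [set w | x < X 0 w]))
      (fun f => \int[Q]_w f (window Y s `|t - s|%N.+1 w)).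

Definition continuity_set (R : realType) (k : nat)
    (mu : set 'rV[R]_k -> \bar R) (A : set 'rV[R]_k) : Prop :=
  borel A /\ mu (closure A `\` A^°) = 0%E.

(* [0,oo) x (1,oo) x [0,oo)^t: position 1 of the row is time 0. *)
Definition exceedance_orthant (R : realType) (t : nat) : set 'rV[R]_t.+2 :=
  [set x | forall i : 'I_t.+2,
    if (i : nat) == 1%N then 1 < x ord0 i else 0 <= x ord0 i].
Arguments exceedance_orthant : clear implicits.

(* Main.v *)
Require Import Defs.
From mathcomp Require Import all_boot all_order all_algebra.
From mathcomp Require Import all_classical all_reals all_analysis.
From mathcomp Require Import measurable_realfun ring lra.
Import Order.TTheory GRing.Theory Num.Theory.
Import numFieldNormedType.Exports.
Local Open Scope classical_set_scope.
Local Open Scope ring_scope.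

Set Implicit Arguments.
Unset Strict Implicit.
Unset Printing Implicit Defensive.

(** Let p_n = P (X 0 > u n). The theorem is a weak law of large numbers for the
    normalised count Phat / p_n, proved separately for A1 and for A0: the ratio
    of the two counts is free of the unknown p_n, and converges by continuity of
    the quotient (cvg_in_probability_ratio).

    The mean of Phat / p_n is, up to a factor (n - t) / n, the probability that
    the rescaled window lies in A, divided by p_n. Since A forces an exceedance
    at time 0, this is a conditional probability given X 0 > u n, and it
    converges to the mass of A under the law of the tail process, by the
    portmanteau theorem for continuity sets (tail_process_continuity_set). That
    theorem is obtained by squeezing the indicator of A between continuous
    functions built from powers of 1 - d, with d the capped distance to a closed
    set (weak_cvg_continuity_set).

    The variance of the count is the double sum of the covariances of the events
    E_k = (the window at time k lies in u A). Two bounds are available: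
    |cov (E_k, E_l)| <= p_n for all k and l and, by stationarity and mixing
    (mixing_windows), |cov (E_k, E_l)| <= C h^(- delta) when the two windows are
    h apart, for h large enough. With the first bound up to a lag m and the second one beyond,
    the variance of the count is at most a constant times
    n (m p_n + m^(1 - delta)), because the tail of the series of h^(- delta) is
    of order m^(1 - delta) (sum_dependence_bound). For m of order
    n^(1 / (1 + delta)) and q_n = n^(delta / (1 + delta)) p_n, the two terms,
    divided by (n p_n)^2, are at most of order 1 / q_n and 1 / q_n^2
    (block_length). The
    assumption that q_n tends to infinity is thus what makes the variance of
    Phat / p_n vanish, and Chebyshev's inequality concludes
    (Phat_consistent). *)

(** * Borel sets of row vectors and measurability of the windows *)

Lemma borel_open (T : topologicalType) (U : set T) : open U -> borel U.
Proof. exact: sub_sigma_algebra. Qed.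

Lemma borel_closed (T : topologicalType) (F : set T) : closed F -> borel F.
Proof.
rewrite -openC => /borel_open bF; rewrite -[F]setCK -setTD.
by apply: sigma_algebraCD.
Qed.

(** The sets B whose preimage lies in a given sigma-algebra themselves form a
    sigma-algebra, so open sets suffice. *)
Lemma borel_preimage_ind (T : Type) (V : topologicalType) (f : T -> V)
    (S : set (set T)) :
  sigma_algebra setT S -> (forall U, open U -> S (f @^-1` U)) ->
  forall B, borel B -> S (f @^-1` B).
Proof.
move=> [S0 SC SU] Sf B; rewrite /borel.
suff /(_ B) : <<s @open V >> `<=` [set B | S (f @^-1` B)] by [].
apply: smallest_sub => //; split => /= [|C SfC|F SF].
- by rewrite preimage_set0.
- by rewrite setTD preimage_setC -setTD; apply: SC.
- by rewrite preimage_bigcup; apply: SU.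
Qed.

Lemma borel_preimage (T V : topologicalType) (f : T -> V) (B : set V) :
  continuous f -> borel B -> borel (f @^-1` B).
Proof.
move=> cf; apply: borel_preimage_ind.
  exact: smallest_sigma_algebra.
by move=> U oU; apply: borel_open; move/continuousP : cf => /(_ _ oU).
Qed.

Lemma borelI (T : ptopologicalType) (A B : set T) :
  borel A -> borel B -> borel (A `&` B).
Proof.
move=> bA bB.
exact: (@measurableI _ (g_sigma_algebraType (@open T)) A B bA bB).
Qed.

(** Only finitely many coordinates are involved, so uniform closeness of all
    of them is a finite intersection of neighbourhoods. *)
Lemma row_continuous (R : realType) (S : topologicalType) k
    (f : 'I_k -> S -> R) :
  (forall i, continuous (f i)) -> continuous (fun x => \row_i f i x).
Proof.
move=> cf x; apply/cvg_mx_entourageP => A eA.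
apply: (@filter_forall _ 'I_1) => i.
apply: filter_forall => j.
have /cvg_entourageP/(_ _ eA) := cf j x.
rewrite !near_map; apply: filterS => y hy; rewrite /preimage/= !mxE.
exact: mem_set.
Qed.

(** The random variables are only assumed measurable one by one, whereas the
    Borel sets are generated by the open sets of the product; the two are
    reconciled by writing an open set as a countable union of cubes with
    rational centres. *)
Lemma margin_preimage_measurable (R : realType) (dT : measure_display)
    (T : measurableType dT) (P : probability T R) (X : int -> {RV P >-> R}) k
    (tau : 'I_k -> int) (B : set 'rV[R]_k) :
  borel B -> measurable (margin X tau @^-1` B).
Proof.
apply: borel_preimage_ind.
  exact: sigma_algebra_measurable.
move=> U oU.
pose box (q : 'rV[rat]_k) (n : nat) :=
  [set v : 'rV[R]_k | forall i, `|ratr (q ord0 i) - v ord0 i| < n.+1%:R^-1].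
have -> : margin X tau @^-1` U =
   \bigcup_(z in [set z : 'rV[rat]_k * nat | box z.1 z.2 `<=` U])
      (margin X tau @^-1` (box z.1 z.2)).
  apply/seteqP; split => w /=; last by move=> [z /= zU] /zU.
  move=> Uw.
  have /nbhs_ballP[e /= e0 eU] : nbhs (margin X tau w) U.
    exact: open_nbhs_nbhs.
  have [n ne] : exists n, n.+1%:R^-1 < e / 2.
    have e20 : 0 < e / 2 by rewrite divr_gt0.
    by have [n _ /(_ _ (leqnn n))] := near_infty_natSinv_lt (PosNum e20); exists n.
  have n0 : 0 < n.+1%:R^-1 :> R by rewrite invr_gt0.
  have qP i : exists q : rat, `|ratr q - margin X tau w ord0 i| < n.+1%:R^-1.
    have /rat_in_itvoo[q] : margin X tau w ord0 i <
        margin X tau w ord0 i + n.+1%:R^-1 by rewrite ltrDl.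
    rewrite in_itv/= => /andP[q1 q2]; exists q.
    by rewrite ger0_norm ?subr_ge0 ?(ltW q1)// ltrBlDl.
  have [q qP'] := choice qP.
  exists (\row_i q i, n) => /=; last by move=> i; rewrite mxE; exact: qP'.
  move=> v /= vq; apply: eU; split => // i j; rewrite ord1 /ball/=.
  have := vq j; rewrite mxE => vqj; have := qP' j => qj.
  rewrite [e]splitr -[X in `|X|](subrKA (ratr (q j))).
  rewrite (le_lt_trans (ler_normD _ _))// ltrD //.
    by rewrite distrC (lt_trans qj).
  by rewrite (lt_trans vqj).
rewrite bigcup_mkcond; apply: countable_bigcupT_measurable => [|[q n]].
  exact: countableP.
case: ifP => // _ /=.
have -> : margin X tau @^-1` box q n =
   \bigcap_(i in [set: 'I_k]) (X (tau i) @^-1` ball (ratr (q ord0 i) : R) n.+1%:R^-1).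
  apply/seteqP; split => w /= h i.
    by move=> _; have := h i; rewrite mxE.
  by rewrite mxE; exact: (h i).
apply: fin_bigcap_measurable => // i _.
rewrite -[_ @^-1` _]setTI.
by apply: measurable_funPT => //; exact: measurable_ball.
Qed.

(** * Approximation of the indicator of a closed set *)

Section CappedDistance.
Context (R : realType) (V : normedModType R).
Implicit Types (F : set V) (x y : V).

(** The distance to F capped at 1. Putting 1 in the set keeps the infimum
    meaningful when F is empty, and makes the value lie in [0, 1]. *)
Definition capdist F x : R := inf (1 |` [set `|x - a| | a in F]).

Lemma capdist_has_inf F x : has_inf (1 |` [set `|x - a| | a in F]).
Proof.
split; first by exists 1; left.
by exists 0 => _ [->|[a _ <-]] //.
Qed.

Lemma capdist_ge0 F x : 0 <= capdist F x.
Proof.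
apply: lb_le_inf; first by exists 1; left.
by move=> _ [->|[a _ <-]] //.
Qed.

Lemma capdist_le1 F x : capdist F x <= 1.
Proof. by apply: ge_inf; [case: (capdist_has_inf F x)|left]. Qed.

Lemma capdist_lip F x y : capdist F x <= capdist F y + `|x - y|.
Proof.
rewrite -lerBlDr; apply: lb_le_inf; first by exists 1; left.
move=> _ [->|[a Fa <-]].
  by rewrite lerBlDr (le_trans (capdist_le1 _ _))// lerDl.
rewrite lerBlDr addrC (le_trans _ (ler_distD y _ _))//.
by apply: ge_inf; [case: (capdist_has_inf F x)|right; exists a].
Qed.

Lemma capdist_continuous F : continuous (capdist F).
Proof.
move=> x; apply/cvgrPdist_lt => e e0; near=> y.
have xy : `|x - y| < e by near: y; exact: cvgr_dist_lt.
rewrite ltr_norml; apply/andP; split.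
  rewrite ltrBrDr addrC -ltrBrDr opprK (le_lt_trans (capdist_lip F y x))//.
  by rewrite ltrD2l distrC.
by rewrite ltrBlDr addrC (le_lt_trans (capdist_lip F x y))// ltrD2l.
Unshelve. all: by end_near. Qed.

Lemma capdist0 F x : F x -> capdist F x = 0.
Proof.
move=> Fx; apply/eqP; rewrite eq_le capdist_ge0 andbT.
apply: ge_inf; first by case: (capdist_has_inf F x).
by right; exists x => //; rewrite subrr normr0.
Qed.

(** A ball around x that misses F has a radius, which capped at 1 bounds the
    capped distance from below. *)
Lemma capdist_gt0 F x : closed F -> ~ F x -> 0 < capdist F x.
Proof.
rewrite -openC => oF Fx.
have /nbhs_ballP[e /= e0 eF] : nbhs x (~` F) by exact: open_nbhs_nbhs.
apply: (@lt_le_trans _ _ (Num.min e 1)); first by rewrite lt_min e0 /=.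
apply: lb_le_inf; first by exists 1; left.
move=> _ [->|[a Fa <-]]; first by rewrite ge_min lexx orbT.
rewrite ge_min; apply/orP; left; rewrite leNgt; apply/negP => xa.
by apply: (eF a) => //; rewrite -ball_normE.
Qed.

(** Equal to 1 on F and, F being closed, decreasing to 0 off F: a sequence of
    bounded continuous functions with limit the indicator of F. *)
Definition capdist_pow F n x : R := (1 - capdist F x) ^+ n.

Lemma capdist_pow_continuous F n : continuous (capdist_pow F n).
Proof.
move=> x.
apply: (@continuous_comp _ _ _ (fun y => 1 - capdist F y)
  (fun z : R => z ^+ n)).
  apply: cvgB; [exact: cvg_cst|exact: capdist_continuous].
exact: exprn_continuous.
Qed.

Lemma capdist_pow_ge0 F n x : 0 <= capdist_pow F n x.
Proof. by rewrite exprn_ge0// subr_ge0 capdist_le1. Qed.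

Lemma capdist_pow_le1 F n x : capdist_pow F n x <= 1.
Proof.
by rewrite exprn_ile1// ?subr_ge0 ?capdist_le1// lerBlDr lerDl capdist_ge0.
Qed.

Lemma capdist_pow1 F n x : F x -> capdist_pow F n x = 1.
Proof. by move=> Fx; rewrite /capdist_pow capdist0// subr0 expr1n. Qed.

Lemma capdist_pow_cvg F x : closed F ->
  capdist_pow F n x @[n --> \oo] --> (\1_F x : R).
Proof.
move=> cF; rewrite indicE; have [/set_mem Fx|/negP Fx] := boolP (x \in F).
  by apply: cvg_near_cst; apply: nearW => n; rewrite capdist_pow1.
apply: cvg_expr.
rewrite ger0_norm ?subr_ge0 ?capdist_le1// ltrBlDr ltrDl capdist_gt0//.
by move=> /mem_set.
Qed.

End CappedDistance.

Lemma bounded_integrable (R : realType) (d : measure_display)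
    (T : measurableType d) (P : probability T R) (D : set T) (f : T -> R)
    (M : R) :
  measurable D -> measurable_fun setT f -> (forall x, `|f x| <= M) ->
  P.-integrable D (EFin \o f).
Proof.
move=> mD mf fM; apply: measurable_bounded_integrable => //.
- by rewrite (le_lt_trans (probability_le1 _ _))// ltry.
- exact: measurable_funTS.
- exists M; split; first exact: num_real.
  by move=> N MN x _; exact: le_trans (fM x) (ltW MN).
Qed.

Lemma Rintegral_indic (R : realType) (d : measure_display)
    (T : measurableType d) (P : probability T R) (D B : set T) :
  measurable D -> measurable B ->
  \int[P]_(w in D) \1_B w = fine (P (B `&` D)).
Proof. by move=> mD mB; rewrite /Rintegral integral_indic. Qed.

(** The dominated convergence theorem for real-valued integrals, with a
    constant as the dominating function. *)
Lemma bounded_cvg_Rintegral (R : realType) (d : measure_display)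
    (T : measurableType d) (P : probability T R) (f_ : nat -> T -> R)
    (f : T -> R) (M : R) :
  (forall n, measurable_fun setT (f_ n)) -> measurable_fun setT f ->
  (forall n x, `|f_ n x| <= M) -> (forall x, f_ n x @[n --> \oo] --> f x) ->
  \int[P]_w f_ n w @[n --> \oo] --> \int[P]_w f w.
Proof.
move=> mf_ mf f_M f_f.
have /= := @dominated_convergence _ _ _ P setT measurableT
  (fun n => EFin \o f_ n) (EFin \o f) (cst M%:E).
case.
- by move=> n; exact/measurable_EFinP.
- exact/measurable_EFinP.
- by apply/aeW => x _; apply/fine_cvgP; split; [exact: nearW|exact: f_f].
- exact: finite_measure_integrable_cst.
- by apply/aeW => x n _ /=; rewrite lee_fin.
move=> intf _ cvf.
apply: fine_cvg; rewrite fineK//; exact: integrable_fin_num.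
Qed.

(** * The portmanteau theorem for continuity sets *)

Lemma borel_measurable_comp (R : realType) (V : topologicalType)
    (d : measure_display)
    (T : measurableType d) (W : T -> V) (f : V -> R) :
  (forall B, borel B -> measurable (W @^-1` B)) -> continuous f ->
  measurable_fun setT (f \o W).
Proof.
move=> mW cf.
have mfW : forall B, borel B -> measurable ((f \o W) @^-1` B).
  by move=> B bB; rewrite comp_preimage; apply: mW; apply: borel_preimage.
apply: (measurability _ (RGenOpens.measurableE R)).
move=> _ [_ [a [b ->]] <-]; rewrite setTI.
by apply: mfW; apply: borel_open; exact: interval_open.
Qed.

Section ContinuitySet.
Context (R : realType) (d : measure_display) (S : measurableType d)
  (Q : probability S R) (k : nat) (W : S -> 'rV[R]_k).
Hypothesis mW : forall B, borel B -> measurable (W @^-1` B).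

Lemma Rintegral_capdist_pow_cvg (F : set 'rV[R]_k) : closed F ->
  \int[Q]_w capdist_pow F n (W w) @[n --> \oo] --> fine (law Q W F).
Proof.
move=> cF.
have mF : measurable (W @^-1` F) by apply: mW; exact: borel_closed.
have -> : fine (law Q W F) = \int[Q]_w \1_(W @^-1` F) w.
  by rewrite Rintegral_indic// setIT.
apply: (@bounded_cvg_Rintegral _ _ _ Q (fun n w => capdist_pow F n (W w))
  (\1_(W @^-1` F) : S -> R) 1).
- by move=> n; apply: (borel_measurable_comp mW); exact: capdist_pow_continuous.
- exact: measurable_indic.
- by move=> n w; rewrite ger0_norm ?capdist_pow_ge0// capdist_pow_le1.
- by move=> w; exact: (@capdist_pow_cvg _ _ F (W w) cF).
Qed.

(** The closure of A exceeds A by a part of the boundary only. *)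
Lemma continuity_set_closure (A : set 'rV[R]_k) : continuity_set (law Q W) A ->
  law Q W (closure A) = law Q W A.
Proof.
move=> [bA A0].
have mA : measurable (W @^-1` A) by exact: mW.
have mcA : measurable (W @^-1` closure A).
  by apply: mW; apply: borel_closed; exact: closed_closure.
have mbA : measurable (W @^-1` (closure A `\` A^°)).
  apply: (measurableD mcA (_ : measurable (W @^-1` A^°))).
  by apply: mW; apply: borel_open; exact: open_interior.
apply/eqP; rewrite eq_le; apply/andP; split; last first.
  by apply: le_measure; rewrite ?inE//; apply: preimage_subset; exact: subset_closure.
rewrite -[leRHS]adde0 -A0.
apply: (le_trans _ (measureU2 _ mA mbA)).
apply: le_measure; rewrite ?inE//; first exact: measurableU.
move=> w /= cw; have [Aw|nAw] := pselect (A (W w)); [by left|right].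
by split => // /interior_subset.
Qed.

Lemma continuity_setC (A : set 'rV[R]_k) : continuity_set (law Q W) A ->
  continuity_set (law Q W) (~` A).
Proof.
move=> [bA A0]; split.
  by rewrite -setTD; exact: sigma_algebraCD.
by rewrite closure_setC interiorC setDE setCK setIC -setDE.
Qed.

(** The quantity r x stands for the mass of A. It is only assumed to be
    squeezed between the values of E x on continuous functions below and above
    the indicator of A, which avoids representing E x by a measure. The test
    functions are capdist_pow of the closure of A, from above, and one minus
    capdist_pow of the closure of the complement, from below. *)
Lemma weak_cvg_continuity_set (E : R -> ('rV[R]_k -> R) -> R) (r : R -> R)
    (A : set 'rV[R]_k) :
  weak_cvg E (fun f => \int[Q]_w f (W w)) ->
  (forall f : 'rV[R]_k -> R, continuous f -> (forall v, 0 <= f v <= \1_A v) ->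
    \forall x \near +oo, E x f <= r x) ->
  (forall f : 'rV[R]_k -> R, continuous f -> (forall v, \1_A v <= f v <= 1) ->
    \forall x \near +oo, r x <= E x f) ->
  continuity_set (law Q W) A ->
  r x @[x --> +oo] --> fine (law Q W A).
Proof.
move=> EW lo hi cA; apply/cvgrPdist_le => e e0.
have bounded01 (f : 'rV[R]_k -> R) : (forall v, 0 <= f v <= 1) -> bounded_fun f.
  move=> f01; exists 1; split; first exact: num_real.
  move=> M M1 v _; have /andP[f0 f1] := f01 v.
  by rewrite /= ger0_norm// (le_trans f1)// ltW.
have indic01 (B : set 'rV[R]_k) v : 0 <= (\1_B v : R) <= 1.
  by rewrite indicE ler0n lern1 leq_b1.
have iB (B : set 'rV[R]_k) n : Q.-integrable setT (EFin \o (capdist_pow B n \o W)).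
  apply: (@bounded_integrable _ _ _ _ _ _ 1) => //.
    by apply: (borel_measurable_comp mW); exact: capdist_pow_continuous.
  by move=> w; rewrite ger0_norm ?capdist_pow_ge0// capdist_pow_le1.
have [n nhi] : exists n, \int[Q]_w capdist_pow (closure A) n (W w) <=
    fine (law Q W A) + e / 2.
  have /cvgrPdist_le/(_ (e / 2)) :=
    Rintegral_capdist_pow_cvg (@closed_closure _ A).
  rewrite divr_gt0// continuity_set_closure// => /(_ isT) [n _ /(_ n (leqnn n))].
  by rewrite /= distrC ler_distl => /andP[_]; exists n.
have [m mlo] : exists m, \int[Q]_w capdist_pow (closure (~` A)) m (W w) <=
    fine (law Q W (~` A)) + e / 2.
  have /cvgrPdist_le/(_ (e / 2)) :=
    Rintegral_capdist_pow_cvg (@closed_closure _ (~` A)).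
  rewrite divr_gt0// continuity_set_closure//; last exact: continuity_setC.
  move=> /(_ isT) [m _ /(_ m (leqnn m))].
  by rewrite /= distrC ler_distl => /andP[_]; exists m.
pose g := capdist_pow (closure A) n.
pose f v := 1 - capdist_pow (closure (~` A)) m v.
have cg : continuous g by exact: capdist_pow_continuous.
have cf : continuous f.
  move=> v; apply: continuousB; first exact: cst_continuous.
  exact: capdist_pow_continuous.
have gA v : \1_A v <= g v <= 1.
  rewrite capdist_pow_le1 andbT indicE; have [/set_mem Av|_] := boolP (v \in A).
    by rewrite /g capdist_pow1//; exact: subset_closure.
  exact: capdist_pow_ge0.
have fA v : 0 <= f v <= \1_A v.
  rewrite subr_ge0 capdist_pow_le1/= indicE; have [_|/negP Av] := boolP (v \in A).
    by rewrite lerBlDr lerDl capdist_pow_ge0.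
  by rewrite /f capdist_pow1 ?subrr//; apply: subset_closure => /mem_set.
have fW : fine (law Q W A) - e / 2 <= \int[Q]_w f (W w).
  rewrite /f RintegralB//; [|exact: finite_measure_integrable_cst|exact: iB].
  rewrite Rintegral_cst// mul1r.
  have -> : fine (Q setT) = 1 by rewrite probability_setT.
  have mA : measurable (W @^-1` A) by apply: mW; case: cA.
  move: mlo; rewrite /law -preimage_setC probability_setC// fineB//; last first.
    exact: fin_num_measure.
  rewrite /=; lra.
have e20 : 0 < e / 2 by rewrite divr_gt0.
have cvE (h : 'rV[R]_k -> R) : continuous h -> (forall v, 0 <= h v <= 1) ->
    \forall x \near +oo, `|\int[Q]_w h (W w) - E x h| <= e / 2.
  move=> ch h01.
  by have /cvgrPdist_le/(_ _ e20) := EW h ch (bounded01 h h01).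
near=> x.
have : `|\int[Q]_w g (W w) - E x g| <= e / 2.
  near: x; apply: cvE => // v; have /andP[g0 ->] := gA v.
  by rewrite (le_trans _ g0)//; have /andP[] := indic01 A v.
rewrite ler_distl => /andP[g1 g2].
have : `|\int[Q]_w f (W w) - E x f| <= e / 2.
  near: x; apply: cvE => // v; have /andP[-> f0] := fA v.
  by rewrite (le_trans f0)//; have /andP[] := indic01 A v.
rewrite ler_distl => /andP[f1 f2].
have fr : E x f <= r x by near: x; exact: lo.
have rg : r x <= E x g by near: x; exact: hi.
rewrite ler_distl; apply/andP; move: nhi; rewrite -/g; split; lra.
Unshelve. all: by end_near. Qed.

End ContinuitySet.

Section TailProcess.
Context (R : realType) (dT dS : measure_display)
  (T : measurableType dT) (S : measurableType dS)
  (P : probability T R) (Q : probability S R)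
  (X : int -> {RV P >-> R}) (Y : int -> {RV Q >-> R}) (alpha : R).

Lemma scaler_preimage_borel k (c : R) (B : set 'rV[R]_k) : borel B ->
  borel [set v | B (c *: v)].
Proof. by apply: borel_preimage => v; exact: scaler_continuous. Qed.

(** A subset of the exceedance orthant asks for an exceedance at time 0, so
    that restricting the integral to X 0 > x loses nothing: the ratio is a
    conditional probability given the exceedance. *)
Lemma tail_process_continuity_set t (A : set 'rV[R]_t.+2) :
  tail_process X Y alpha -> A `<=` exceedance_orthant R t ->
  continuity_set (law Q (window Y (-1) t.+2)) A ->
  fine (P [set w | A (x^-1 *: window X (-1) t.+2 w)]) /
    fine (P [set w | x < X 0 w]) @[x --> +oo] -->
  fine (law Q (window Y (-1) t.+2) A).
Proof.
move=> [_ /(_ (-1) t%:Z)].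
(* There are t + 2 times from -1 to t. *)
have -> : (absz (t%:Z - (-1 : int))%R).+1 = t.+2 by rewrite opprK /= addn1.
move=> /(_ isT) XY Aorth cA.
have mA x : measurable [set w | A (x^-1 *: window X (-1) t.+2 w)].
  apply: (@margin_preimage_measurable _ _ _ P X _ _ [set v | A (x^-1 *: v)]).
  by apply: scaler_preimage_borel; case: cA.
have mX x : measurable [set w | x < X 0 w].
  by rewrite -[X in measurable X]setTI; exact: measurable_fun_ltr.
have mV x (f : 'rV[R]_t.+2 -> R) : continuous f ->
    measurable_fun setT (fun w => f (x^-1 *: window X (-1) t.+2 w)).
  move=> cf; apply: (@borel_measurable_comp _ _ _ _
    (fun w => x^-1 *: window X (-1) t.+2 w) f) => // B bB.
  by apply: (@margin_preimage_measurable _ _ _ P X _ _ [set v | B (x^-1 *: v)]);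
    exact: scaler_preimage_borel.
have iV x (f : 'rV[R]_t.+2 -> R) : continuous f -> (forall v, 0 <= f v <= 1) ->
    P.-integrable [set w | x < X 0 w]
      (EFin \o (fun w => f (x^-1 *: window X (-1) t.+2 w))).
  move=> cf f01; apply: (@bounded_integrable _ _ _ _ _ _ 1) => //; first exact: mV.
  by move=> w; have /andP[f0 f1] := f01 (x^-1 *: window X (-1) t.+2 w);
    rewrite ger0_norm.
have i1 x : P.-integrable [set w | x < X 0 w]
      (EFin \o \1_[set w | A (x^-1 *: window X (-1) t.+2 w)]).
  apply: (@bounded_integrable _ _ _ _ _ _ 1) => //.
  by move=> w; rewrite indicE; case: (_ \in _); rewrite ?normr1 ?normr0.
have Pint x : 0 < x -> P [set w | A (x^-1 *: window X (-1) t.+2 w)] =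
    P ([set w | A (x^-1 *: window X (-1) t.+2 w)] `&` [set w | x < X 0 w]).
  move=> x0; congr (P _); apply/seteqP; split => w /=; last by case.
  (* The window starts at time -1, so its coordinate 1 is time 0. *)
  move=> Aw; split => //; have := Aorth _ Aw (inord 1).
  rewrite inordK//= !mxE inordK//=.
  by rewrite ltr_pdivlMl// mulr1.
have indic01 v : 0 <= (\1_A v : R) <= 1.
  by rewrite indicE ler0n lern1 leq_b1.
apply: (weak_cvg_continuity_set _ XY) => //.
- by move=> B bB; exact: margin_preimage_measurable.
- move=> f cf fA; near=> x; have x0 : 0 < x by [].
  rewrite Pint// ler_wpM2r ?invr_ge0 ?fine_ge0// -Rintegral_indic//.
  apply: le_Rintegral => //; first apply: iV => //.
    move=> v; have /andP[-> f1] := fA v.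
    by rewrite (le_trans f1)//; have /andP[] := indic01 v.
  by move=> w _; have /andP[_] := fA (x^-1 *: window X (-1) t.+2 w).
- move=> f cf fA; near=> x; have x0 : 0 < x by [].
  rewrite Pint// ler_wpM2r ?invr_ge0 ?fine_ge0// -Rintegral_indic//.
  apply: le_Rintegral => //; first apply: iV => //.
    move=> v; have /andP[f1 ->] := fA v.
    by rewrite (le_trans _ f1)//; have /andP[] := indic01 v.
  by move=> w _; have /andP[] := fA (x^-1 *: window X (-1) t.+2 w).
Unshelve. all: by end_near. Qed.

End TailProcess.

(** * Covariance of two windows under mixing *)

Section Mixing.
Context (R : realType) (dT : measure_display) (T : measurableType dT)
  (P : probability T R) (X : int -> {RV P >-> R}).
Hypothesis X_stationary : strictly_stationary X.

Lemma subrow_continuous k m (sigma : 'I_k -> 'I_m) :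
  continuous (fun v : 'rV[R]_m => \row_i v ord0 (sigma i) : 'rV[R]_k).
Proof. by apply: row_continuous => i v; exact: coord_continuous. Qed.

(** Stationarity concerns a single margin, so both windows are read off one
    margin of length m + m; they may overlap, as the margin may list a time
    twice. *)
Lemma stationary_windows m (a b s : int) (B B' : set 'rV[R]_m) :
  borel B -> borel B' ->
  P (window X (a + s) m @^-1` B `&` window X (b + s) m @^-1` B') =
  P (window X a m @^-1` B `&` window X b m @^-1` B').
Proof.
move=> bB bB'.
pose tau (i : 'I_(m + m)) : int :=
  match fintype.split i with
  | inl j => a + (j : nat)%:Z
  | inr j => b + (j : nat)%:Z
  end.
pose C := [set v : 'rV[R]_(m + m) | B (\row_i v ord0 (lshift m i))] `&`
          [set v : 'rV[R]_(m + m) | B' (\row_i v ord0 (rshift m i))].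
have bC : borel C.
  by apply: borelI; [have := bB|have := bB']; apply: borel_preimage;
    exact: subrow_continuous.
have marginE (s' : int) : margin X (fun i => tau i + s') @^-1` C =
    window X (a + s') m @^-1` B `&` window X (b + s') m @^-1` B'.
  rewrite preimage_setI; congr (_ `&` _); apply/seteqP; split => w /=;
    (set v := \row_i _; set v' := window _ _ _ _; suff -> : v = v' by []);
    apply/rowP => i; rewrite !mxE /tau ?(unsplitK (inl i)) ?(unsplitK (inr i));
    by rewrite addrAC.
have := X_stationary tau s bC; rewrite /law marginE => ->.
have := marginE 0; rewrite !addr0 => <-.
by congr (P _); apply/seteqP; split => w /=;
  (set v := margin _ _ _; set v' := margin _ _ _; suff -> : v = v' by []);
  apply/rowP => i; rewrite !mxE addr0.
Qed.

Lemma stationary_window m (a b : int) (B : set 'rV[R]_m) : borel B ->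
  P (window X a m @^-1` B) = P (window X b m @^-1` B).
Proof.
move=> bB; have := stationary_windows b b (a - b) bB bB.
by rewrite !setIid addrC subrK.
Qed.

(** Both events are cylinder events: the first depends on the past through m +
    1 coordinates only, in reverse order since past runs backwards, and the
    second on the first m + 1 coordinates of the future. *)
Lemma mixing_windows_at0 m (h : nat) (B B' : set 'rV[R]_m.+1) :
  borel B -> borel B' ->
  (`| P (window X (- m%:Z) m.+1 @^-1` B `&` window X h%:Z m.+1 @^-1` B') -
      P (window X (- m%:Z) m.+1 @^-1` B) * P (window X h%:Z m.+1 @^-1` B') |
   <= alpha_mixing X h)%E.
Proof.
move=> bB bB'; apply: ereal_sup_ubound.
pose S := prod_topology (fun _ : nat => R).
pose F (f : S) : 'rV[R]_m.+1 := \row_i f (m - i)%N.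
pose F' (f : S) : 'rV[R]_m.+1 := \row_i f (i : nat).
have cF : continuous F by apply: row_continuous => i; exact: proj_continuous.
have cF' : continuous F' by apply: row_continuous => i; exact: proj_continuous.
exists (F @^-1` B), (F' @^-1` B'); split; [exact: borel_preimage..|].
have -> : past X @^-1` (F @^-1` B) = window X (- m%:Z) m.+1 @^-1` B.
  apply/seteqP; split => w /=;
    (set v := F _; set v' := window _ _ _ _; suff -> : v = v' by []);
    apply/rowP => i; rewrite !mxE /past -subzn ?opprB 1?addrC//; exact: leq_ord.
have -> // : future X h @^-1` (F' @^-1` B') = window X h%:Z m.+1 @^-1` B'.
by apply/seteqP; split => w /=;
    (set v := F' _; set v' := window _ _ _ _; suff -> : v = v' by []);
    apply/rowP => i; rewrite !mxE.
Qed.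

(** The first window, moved so as to end at time 0, leaves a gap d - m before
    the second one. *)
Lemma mixing_windows m (a : int) (d : nat) (B B' : set 'rV[R]_m.+1) :
  borel B -> borel B' -> (m <= d)%N ->
  (`| P (window X a m.+1 @^-1` B `&` window X (a + d%:Z) m.+1 @^-1` B') -
      P (window X a m.+1 @^-1` B) * P (window X (a + d%:Z) m.+1 @^-1` B') |
   <= alpha_mixing X (d - m))%E.
Proof.
move=> bB bB' md; have := mixing_windows_at0 (d - m)%N bB bB'.
have := stationary_windows (- m%:Z) (d - m)%N%:Z (a + m%:Z) bB bB'.
rewrite -subzn// !(addrC _ (a + m%:Z)) addrK -[in X in X = _ -> _]addrA.
rewrite (addrC m%:Z) subrK => <-.
by rewrite (stationary_window _ a bB) (stationary_window _ (a + d%:Z) bB').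
Qed.

End Mixing.

(** * Chebyshev's inequality for counts *)

Section CountVariance.
Context (R : realType) (d : measure_display) (T : measurableType d)
  (P : probability T R).

Lemma Rintegral_sum n (f : nat -> T -> R) :
  (forall k, P.-integrable setT (EFin \o f k)) ->
  \int[P]_w (\sum_(k < n) f k w) = \sum_(k < n) \int[P]_w f k w.
Proof.
move=> fint; elim: n => [|n IHn].
  by under eq_Rintegral do rewrite big_ord0; rewrite big_ord0 Rintegral_cst ?mul0r.
under eq_Rintegral do rewrite big_ord_recr/=.
rewrite RintegralD//; first by rewrite IHn big_ord_recr.
have := @integrable_sum _ _ _ P setT measurableT 'I_n (index_enum _) xpredT
  (fun k => EFin \o f k).
move=> /(_ (fun _ _ => fint _)); congr (integrable _ _ _).
by apply/funext => w /=; rewrite sumEFin.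
Qed.

(** Markov's inequality for the square of the centred count; the right-hand
    side is its variance, expanded as a double sum of covariances of
    indicators. *)
Lemma chebyshev_count (A : nat -> set T) (a : R) n (eta : R) : 0 < eta ->
  (forall k, measurable (A k)) -> (forall k, fine (P (A k)) = a) ->
  eta ^+ 2 * fine (P [set w | eta <= `|\sum_(k < n) (\1_(A k) w - a)|]) <=
  \sum_(k < n) \sum_(l < n) (fine (P (A k `&` A l)) - a * a).
Proof.
move=> eta0 mA PA.
have a0 : 0 <= a by rewrite -(PA 0%N) fine_ge0.
have mf k : measurable_fun setT (fun w => \1_(A k) w - a : R).
  by apply: measurable_funB => //; exact: measurable_indic.
have fM k w : `|\1_(A k) w - a| <= 1 + a.
  rewrite (le_trans (ler_normB _ _))// (ger0_norm a0) lerD2r.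
  by rewrite indicE ger0_norm ?ler0n// lern1 leq_b1.
have ifg k l : P.-integrable setT
    (EFin \o (fun w => (\1_(A k) w - a) * (\1_(A l) w - a))).
  apply: (@bounded_integrable _ _ _ _ _ _ ((1 + a) * (1 + a))) => //.
    exact: measurable_funM.
  by move=> w; rewrite normrM ler_pM.
pose S w : R := \sum_(k < n) (\1_(A k) w - a).
have mS : measurable_fun setT S by exact: measurable_sum.
have SM w : `|S w| <= (1 + a) *+ n.
  rewrite (le_trans (ler_norm_sum _ _ _))//.
  rewrite -[in leRHS](card_ord n) -sumr_const.
  by apply: ler_sum => i _; exact: fM.
have S2E w : S w ^+ 2 =
    \sum_(k < n) \sum_(l < n) (\1_(A k) w - a) * (\1_(A l) w - a).
  by rewrite expr2 /S mulr_suml; apply: eq_bigr => k _; rewrite mulr_sumr.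
have covE k l : \int[P]_w ((\1_(A k) w - a) * (\1_(A l) w - a)) =
    fine (P (A k `&` A l)) - a * a.
  have i1 B : measurable B -> P.-integrable setT (EFin \o (\1_B : T -> R)).
    move=> mB; apply: (@bounded_integrable _ _ _ _ _ _ 1) => //.
    by move=> w; rewrite indicE ger0_norm ?ler0n// lern1 leq_b1.
  have ia B : measurable B -> P.-integrable setT (EFin \o (fun w => \1_B w * a)).
    move=> mB; apply: (@bounded_integrable _ _ _ _ _ _ a) => //.
      by apply: measurable_funM => //; exact: measurable_indic.
    move=> w; rewrite normrM (ger0_norm a0) ler_piMl//.
    by rewrite indicE ger0_norm ?ler0n// lern1 leq_b1.
  rewrite (_ : (fun w => _) = (fun w => (\1_(A k `&` A l) w - \1_(A k) w * a) -
      (\1_(A l) w * a - a * a))); last first.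
    by apply/funext => w; rewrite indicI /=; ring.
  have mkl : measurable (A k `&` A l) by exact: measurableI.
  have ic : P.-integrable setT (EFin \o cst (a * a)).
    exact: finite_measure_integrable_cst.
  have iB1 : P.-integrable setT
     (EFin \o (fun w => \1_(A k `&` A l) w - \1_(A k) w * a)).
    exact: (integrableB measurableT (i1 _ mkl) (ia _ (mA k))).
  have iB2 : P.-integrable setT (EFin \o (fun w => \1_(A l) w * a - a * a)).
    exact: (integrableB measurableT (ia _ (mA l)) ic).
  rewrite (RintegralB measurableT iB1 iB2).
  rewrite (RintegralB measurableT (i1 _ mkl) (ia _ (mA k))).
  rewrite (RintegralB measurableT (ia _ (mA l)) ic).
  rewrite (RintegralZr _ measurableT (i1 _ (mA k))).
  rewrite (RintegralZr _ measurableT (i1 _ (mA l))).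
  rewrite !Rintegral_indic// !setIT !PA Rintegral_cst//.
  have -> : fine (P setT) = 1 by rewrite probability_setT.
  by ring.
have ES2 : \int[P]_w (S w ^+ 2) =
    \sum_(k < n) \sum_(l < n) (fine (P (A k `&` A l)) - a * a).
  under eq_Rintegral do rewrite S2E.
  rewrite (@Rintegral_sum n (fun k w =>
    \sum_(l < n) (\1_(A k) w - a) * (\1_(A l) w - a))).
    apply: eq_bigr => k _.
    rewrite (@Rintegral_sum n (fun l w => (\1_(A k) w - a) * (\1_(A l) w - a)))//.
    by apply: eq_bigr => l _; exact: covE.
  move=> k.
  apply: (@bounded_integrable _ _ _ _ _ _ ((1 + a) * (1 + a) *+ n)) => //.
    by apply: measurable_sum => l; exact: measurable_funM.
  move=> w; rewrite (le_trans (ler_norm_sum _ _ _))//.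
  rewrite -[in leRHS](card_ord n) -sumr_const.
  by apply: ler_sum => i _; rewrite normrM ler_pM.
pose D := [set w | eta <= `|S w|].
have mD : measurable D.
  rewrite -[D]setTI; apply: measurable_fun_ler => //.
  by apply: measurableT_comp => //; exact: normr_measurable.
have iS2 : P.-integrable setT (EFin \o (fun w => S w ^+ 2)).
  apply: (@bounded_integrable _ _ _ _ _ _ (((1 + a) *+ n) ^+ 2)) => //.
    exact: measurable_funX.
  by move=> w; rewrite normrX lerXn2r// nnegrE ?(le_trans _ (SM w)).
rewrite -ES2 -/D -[D]setIT -Rintegral_indic// -RintegralZl//; last first.
  apply: (@bounded_integrable _ _ _ _ _ _ 1) => //.
  by move=> w; rewrite indicE ger0_norm ?ler0n// lern1 leq_b1.
apply: le_Rintegral => //.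
  apply: (@bounded_integrable _ _ _ _ _ _ (eta ^+ 2)) => //.
    by apply: measurable_funM => //; exact: measurable_indic.
  move=> w; rewrite normrM ger0_norm ?sqr_ge0// ler_piMr ?sqr_ge0//.
  by rewrite indicE ger0_norm ?ler0n// lern1 leq_b1.
move=> w _; rewrite indicE; have [/set_mem Dw|_] := boolP (w \in D).
  by rewrite mulr1 -[leRHS]real_normK ?num_real// lerXn2r ?nnegrE// ltW.
by rewrite mulr0 sqr_ge0.
Qed.

End CountVariance.

(** * Summing the covariances *)

(** Each row of the symmetric matrix c meets each lag at most twice. The
    induction on the size m adds a last row and a last column, each bounded by
    the sum of b. *)
Lemma sum_dist_le (R : realDomainType) (c : nat -> nat -> R) (b : nat -> R) n :
  (forall k l, (k <= l)%N -> c k l <= b (l - k)%N) ->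
  (forall k l, c k l = c l k) -> (forall k, 0 <= b k) ->
  \sum_(k < n) \sum_(l < n) c k l <= 2 * n%:R * \sum_(j < n) b j.
Proof.
move=> cb cC b0.
suff H m : (m <= n)%N ->
    \sum_(k < m) \sum_(l < m) c k l <= 2 * m%:R * \sum_(j < n) b j.
  exact: H.
elim: m => [|m IHm] mn; first by rewrite big_ord0 mulr0 mul0r.
rewrite big_ord_recr/= big_ord_recr/=.
under eq_bigr do rewrite big_ord_recr/=.
rewrite big_split/=.
have -> : \sum_(k < m) c k m = \sum_(k < m) c m k.
  by apply: eq_bigr => k _; exact: cC.
have cm k : (k <= m)%N -> c m k <= b (m - k)%N by rewrite cC; exact: cb.
have S0 : \sum_(k < m) c m k + c m m <= \sum_(j < n) b j.
  rewrite -(big_ord_recr m (fun k => c m k))/=.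
  apply: (@le_trans _ _ (\sum_(k < m.+1) b (m - k)%N)).
    by apply: ler_sum => k _; apply: cm; exact: leq_ord.
  rewrite (reindex_inj rev_ord_inj)/=.
  under eq_bigr => k _ do rewrite subSS subKn ?leq_ord//.
  rewrite -(big_mkord xpredT b) -(big_mkord xpredT b).
  rewrite (big_cat_nat (leq0n _) mn)//= lerDl.
  by apply: sumr_ge0.
have S1 : \sum_(k < m) c m k <= \sum_(j < n) b j.
  apply: (@le_trans _ _ (\sum_(k < m) b (m - k)%N)).
    by apply: ler_sum => k _; apply: cm; exact: ltnW.
  rewrite (reindex_inj rev_ord_inj)/=.
  under eq_bigr => k _ do rewrite subKn//.
  rewrite -(big_mkord xpredT (fun k => b k.+1)) -(big_mkord xpredT b).
  rewrite -(big_add1 _ _ 0 m.+1 xpredT b) /=.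
  rewrite (big_cat_nat (leq0n 1) (leq_trans (ltn0Sn m) mn))//=.
  rewrite [X in _ <= _ + X](big_cat_nat (ltn0Sn m) mn)//=.
  by rewrite addrCA lerDl addr_ge0 ?sumr_ge0.
have := IHm (ltnW mn); rewrite -natr1.
by move: S0 S1; lra.
Qed.

Section PowerTail.
Context (R : realType) (delta : R).
Hypothesis delta_gt1 : 1 < delta.

(** An elementary form of the comparison of the series with an integral: with
    y = x + 1, the ratio (x / y)^(1 - delta) is exp ((delta - 1) * - ln (1 -
    1/y)), which is at least 1 + (delta - 1) / y. *)
Lemma powR_telescope (x : R) : 0 < x ->
  (delta - 1) * (x + 1) `^ (- delta) <=
  x `^ (1 - delta) - (x + 1) `^ (1 - delta).
Proof.
move=> x0; have y0 : 0 < x + 1 by rewrite addr_gt0.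
have yE : (x + 1) `^ (1 - delta) = (x + 1) * (x + 1) `^ (- delta).
  by rewrite powRD ?powRr1 ?ltW//; apply/implyP => _; rewrite gt_eqF.
have xE : x `^ (1 - delta) = (x + 1) `^ (1 - delta) *
    expR ((delta - 1) * - ln (x / (x + 1))).
  rewrite /powR !gt_eqF// -expRD ln_div ?posrE//; congr expR; ring.
have ln_le : ln (x / (x + 1)) <= - (x + 1)^-1.
  have -> : x / (x + 1) = 1 + - (x + 1)^-1.
    by field; rewrite lt0r_neq0.
  apply: le_ln1Dx; rewrite ltrN2 invf_lt1// ltrDr//.
rewrite lerBrDr xE.
apply: (@le_trans _ _ ((x + 1) `^ (1 - delta) * (1 + (delta - 1) * (x + 1)^-1))).
  rewrite le_eqVlt; apply/orP; left; apply/eqP; rewrite yE.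
  by field; rewrite lt0r_neq0.
rewrite ler_wpM2l ?powR_ge0// (le_trans _ (expR_ge1Dx _))// lerD2l.
by rewrite ler_wpM2l ?subr_ge0 1?[_ <= delta]ltW// lerNr.
Qed.

(** Bound on the covariance of two indicators at lag j: p while j is below m +
    s, and then the mixing rate for the gap (j - s).+1 left between windows of
    length s. *)
Definition dependence_bound (p C : R) (m s j : nat) : R :=
  if (j < m + s)%N then p else C * (j - s).+1%:R `^ (- delta).

(** The lags below m + s contribute p each, and the other ones telescope. *)
Lemma sum_dependence_bound (p C : R) (m s n : nat) :
  0 <= p -> 0 <= C -> (0 < m)%N ->
  \sum_(j < n) dependence_bound p C m s j <=
  (m + s)%:R * p + C / (delta - 1) * m%:R `^ (1 - delta).
Proof.
move=> p0 C0 m0.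
have b0 j : 0 <= dependence_bound p C m s j.
  by rewrite /dependence_bound; case: ifP => // _; rewrite mulr_ge0 ?powR_ge0.
have d0 : 0 < delta - 1 by rewrite subr_gt0.
have H r : \sum_(j < m + s + r) dependence_bound p C m s j <=
    (m + s)%:R * p + C / (delta - 1) *
      (m%:R `^ (1 - delta) - (m + r)%:R `^ (1 - delta)).
  elim: r => [|r IHr].
    rewrite addn0 addn0 subrr mulr0 addr0 mulr_natl.
    rewrite -[in leRHS](card_ord (m + s)) -sumr_const.
    by apply: ler_sum => i _; rewrite /dependence_bound ltn_ord.
  rewrite !addnS big_ord_recr/=.
  rewrite [X in _ + X](_ : _ = C * (m + r).+1%:R `^ (- delta)); last first.
    rewrite /dependence_bound ltnNge leq_addr/=; congr (_ * _ `^ _).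
    by rewrite addnAC addnK.
  have mr0 : 0 < (m + r)%:R :> R by rewrite ltr0n addn_gt0 m0.
  have := powR_telescope mr0; rewrite natr1 => tele.
  have Ctele : C * (m + r).+1%:R `^ (- delta) <= C / (delta - 1) *
      ((m + r)%:R `^ (1 - delta) - (m + r).+1%:R `^ (1 - delta)).
    rewrite -mulrA ler_wpM2l// ler_pdivlMl//.
  apply: (le_trans (lerD IHr Ctele)).
  by rewrite -addrA lerD2l -mulrDr addrA subrK.
apply: (@le_trans _ _ (\sum_(j < m + s + n) dependence_bound p C m s j)).
  rewrite -!(big_mkord xpredT (dependence_bound p C m s)).
  rewrite [leRHS](big_cat_nat (leq0n n) (leq_addl _ _))//= lerDl.
  exact: sumr_ge0.
apply: (le_trans (H n)); rewrite lerD2l ler_wpM2l ?divr_ge0 1?[0 <= _ - _]ltW//.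
by rewrite gerBl powR_ge0.
Qed.

End PowerTail.

Section CountDeviation.
Context (R : realType) (dT : measure_display) (T : measurableType dT)
  (P : probability T R) (X : int -> {RV P >-> R}).
Hypothesis X_stationary : strictly_stationary X.
Context (delta : R) (delta_gt1 : 1 < delta) (C : R) (n0 : nat).
Hypothesis C_ge0 : 0 <= C.
Hypothesis X_mixing : forall h, (n0 <= h)%N ->
  (alpha_mixing X h <= (C * h%:R `^ (- delta))%:E)%E.

(** Chebyshev's inequality with the covariances bounded by dependence_bound.
    The lag m is free here; it is chosen in block_length. *)
Lemma count_deviation t (B : set 'rV[R]_t.+2) (p eta : R) (m N : nat) :
  borel B -> fine (P (window X 0 t.+2 @^-1` B)) <= p ->
  (n0 <= m)%N -> (0 < m)%N -> 0 < eta ->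
  eta ^+ 2 * fine (P [set w | eta <= `|\sum_(k < N)
     (\1_B (window X (k : nat)%:Z t.+2 w) -
       fine (P (window X 0 t.+2 @^-1` B)))|]) <=
  2 * N%:R * ((m + t.+2)%:R * p + C / (delta - 1) * m%:R `^ (1 - delta)).
Proof.
move=> bB Bp n0m m0 eta0.
move: Bp; set a := fine (P (window X 0 t.+2 @^-1` B)) => Bp.
have a0 : 0 <= a by exact: fine_ge0.
have p0 : 0 <= p by exact: le_trans a0 Bp.
have mB j : measurable (window X j t.+2 @^-1` B).
  exact: margin_preimage_measurable.
have a1 : a <= 1.
  rewrite -lee_fin fineK ?fin_num_measure//; exact: probability_le1.
pose E (k : nat) := window X k%:Z t.+2 @^-1` B.
have PE k : fine (P (E k)) = a by rewrite /E (stationary_window X_stationary _ 0 bB).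
apply: (le_trans (chebyshev_count N eta0 (fun k => mB k%:Z) PE)).
pose c k l := `|fine (P (E k `&` E l)) - a * a|.
apply: (@le_trans _ _ (\sum_(k < N) \sum_(l < N) c k l)).
  by apply: ler_sum => k _; apply: ler_sum => l _; exact: ler_norm.
pose b := dependence_bound delta p C m t.+2.
have b0 j : 0 <= b j.
  by rewrite /b /dependence_bound; case: ifP => // _; rewrite mulr_ge0 ?powR_ge0.
apply: (@le_trans _ _ (2 * N%:R * \sum_(j < N) b j)); last first.
  by rewrite ler_wpM2l//; exact: sum_dependence_bound.
apply: sum_dist_le => // k l; last by rewrite /c setIC.
move=> kl; rewrite /b /dependence_bound; case: ifPn => [_|].
  have Ekl : fine (P (E k `&` E l)) <= a.
    have mE j : measurable (E j) by exact: mB.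
    have mEkl : measurable (E k `&` E l) by exact: measurableI.
    rewrite -(PE k); apply: fine_le; rewrite ?fin_num_measure//.
    by apply: le_measure; rewrite ?inE.
  have Ekl0 : 0 <= fine (P (E k `&` E l)) by exact: fine_ge0.
  have aa : a * a <= a by rewrite ler_piMl.
  have aa0 : 0 <= a * a by rewrite mulr_ge0.
  by rewrite /c ler_norml; apply/andP; split; lra.
rewrite -leqNgt => md.
have := mixing_windows X_stationary k%:Z bB bB
  (_ : t.+1 <= l - k)%N.
move=> /(_ (leq_trans (leq_trans (leqnSn _) (leq_addl m _)) md)).
rewrite -PoszD subnKC// -/(E k) -/(E l).
have h_ge : (n0 <= l - k - t.+1)%N.
  rewrite leq_subRL; last exact: leq_trans (leq_trans (leqnSn _) (leq_addl m _)) md.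
  by rewrite addnC (leq_trans _ md)// leq_add.
move=> /le_trans /(_ (X_mixing h_ge)).
have -> : (l - k - t.+1 = (l - k - t.+2).+1)%N.
  by rewrite [in RHS]subnS prednK// subn_gt0 (leq_trans _ md)// leq_addl.
have PEE j : P (E j) = a%:E by rewrite -(PE j) fineK// fin_num_measure//; exact: mB.
have mEkl : measurable (E k `&` E l) by apply: measurableI; exact: mB.
rewrite !PEE -[P (E k `&` E l)]fineK; last exact: fin_num_measure.
by rewrite -EFinM -EFinB abse_EFin lee_fin.
Qed.

End CountDeviation.

(** * Consistency of the estimators *)

(** The lag m balancing the two parts of the variance bound is of order y =
    n^(1 / (1 + delta)): then n = y * y^delta and q = y^delta * p, hence m p
    and m^(1 - delta) are, up to constants, n p^2 / q and n p^2 / q^2. Adding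
    n0 makes m exceed the lag from which the mixing rate is valid. *)
Lemma block_length (R : realType) (delta K p : R) (n0 s n : nat) :
  1 < delta -> 0 <= K -> 0 < p -> (0 < n)%N ->
  let q := n%:R `^ (delta / (1 + delta)) * p in
  exists m, [/\ (n0 <= m)%N, (0 < m)%N &
    (m + s)%:R * p + K * m%:R `^ (1 - delta) <=
      n%:R * p ^+ 2 * ((2 + n0 + s)%:R / q + K / q ^+ 2)].
Proof.
move=> delta1 K0 p0 n0' q.
have d1 : 0 < 1 + delta by lra.
have nR : 1 <= n%:R :> R by rewrite ler1n.
pose y : R := n%:R `^ (1 + delta)^-1.
have y1 : 1 <= y.
  by rewrite -(powRr0 n%:R) ler_powR// invr_ge0 ltW.
have y0 : 0 < y by exact: lt_le_trans y1.
have Y0 : 0 < y `^ delta by exact: powR_gt0.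
have qE : q = y `^ delta * p by rewrite /q /y -powRrM (mulrC delta).
have nE : n%:R = y * y `^ delta.
  have -> : y * y `^ delta = y `^ (1 + delta).
    by rewrite powRD ?powRr1 ?(ltW y0)// (gt_eqF y0) implybT.
  by rewrite /y -powRrM mulVf ?gt_eqF// powRr1.
have yE : y `^ (1 - delta) = y / y `^ delta.
  by rewrite powRB ?powRr1 ?(ltW y0)// (gt_eqF y0) implybT.
exists (n0 + (Num.truncn y).+1)%N; split; [by rewrite leq_addr|by rewrite addnS|].
have my : y <= (n0 + (Num.truncn y).+1)%:R.
  by rewrite natrD (le_trans (ltW (Num.Theory.truncnS_gt y)))// lerDr.
have m0 : 0 < (n0 + (Num.truncn y).+1)%:R :> R by exact: lt_le_trans my.
have -> : n%:R * p ^+ 2 * ((2 + n0 + s)%:R / q + K / q ^+ 2) =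
    (2 + n0 + s)%:R * y * p + K * y `^ (1 - delta).
  by rewrite qE nE yE; field; rewrite !gt_eqF.
apply: lerD.
  rewrite ler_wpM2r ?(ltW p0)// !natrD -[(Num.truncn y).+1%:R]natr1.
  have : (Num.truncn y)%:R <= y by rewrite Num.Theory.truncn_le ltW.
  have : n0%:R <= n0%:R * y by rewrite ler_peMr.
  have : s%:R <= s%:R * y by rewrite ler_peMr.
  by move: y1; lra.
rewrite ler_wpM2l// -opprB !powRN lef_pV2 ?posrE ?(powR_gt0 _ y0) ?(powR_gt0 _ m0)//.
by rewrite ge0_ler_powR ?nnegrE ?(ltW y0) ?(ltW m0)// subr_ge0 ltW.
Qed.

(** Where Z1 and Z0 are within eta of l1 and l0, the denominator stays above
    l0 / 2 and the quotient is Lipschitz; eta is chosen accordingly. *)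
Lemma cvg_in_probability_ratio (R : realType) (dT : measure_display)
    (T : measurableType dT) (P : probability T R)
    (Z1 Z0 Q : nat -> T -> R) (l1 l0 : R) :
  0 < l0 ->
  (\forall n \near \oo, [/\ measurable_fun setT (Z1 n),
     measurable_fun setT (Z0 n), measurable_fun setT (Q n) &
     forall w, Z0 n w != 0 -> Q n w = Z1 n w / Z0 n w]) ->
  cvg_in_probability P Z1 l1 -> cvg_in_probability P Z0 l0 ->
  cvg_in_probability P Q (l1 / l0).
Proof.
move=> l00 nearQ Zl1 Zl0 eps eps0.
pose eta := Num.min (l0 / 2) (eps * l0 ^+ 2 / (2 * (l0 + `|l1|))).
have L0 : 0 < l0 + `|l1| by rewrite ltr_pwDl.
have eta0 : 0 < eta.
  by rewrite lt_min divr_gt0//= divr_gt0 ?mulr_gt0 ?exprn_gt0.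
have etal : eta <= l0 / 2 by rewrite ge_min lexx.
have etae : eta * (2 * (l0 + `|l1|)) <= eps * l0 ^+ 2.
  by rewrite -ler_pdivlMr ?mulr_gt0// ge_min lexx orbT.
have mdist (Z : T -> R) l e : measurable_fun setT Z ->
    measurable [set w | e < `|Z w - l|].
  move=> mZ; rewrite -[X in measurable X]setTI; apply: measurable_fun_ltr => //.
  by apply: measurableT_comp => //; apply: measurable_funB.
apply: (@squeeze_cvge _ _ _ _ (cst 0%E) _ (fun n =>
    (P [set w | (eta < `|Z1 n w - l1|)%R] +
     P [set w | (eta < `|Z0 n w - l0|)%R])%E)).
- near=> n; have [m1 m0 mQ QE] : [/\ measurable_fun setT (Z1 n),
     measurable_fun setT (Z0 n), measurable_fun setT (Q n) &
     forall w, Z0 n w != 0 -> Q n w = Z1 n w / Z0 n w] by near: n.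
  rewrite measure_ge0/=.
  apply: (le_trans _ (measureU2 _ (mdist _ _ _ m1) (mdist _ _ _ m0))).
  apply: le_measure; rewrite ?inE//; [exact: mdist| |].
    by apply: measurableU; exact: mdist.
  move=> w /= epsQ; apply/orP; rewrite -[_ || _]negbK negb_or -!leNgt.
  apply/negP => /andP[d1 d0]; move: epsQ; apply/negP; rewrite -leNgt.
  have Z0l : l0 / 2 <= Z0 n w.
    by move: d0; rewrite ler_distl => /andP[+ _]; lra.
  have Z00 : 0 < Z0 n w by rewrite (lt_le_trans _ Z0l)// divr_gt0.
  rewrite QE ?gt_eqF//.
  have -> : Z1 n w / Z0 n w - l1 / l0 =
      ((Z1 n w - l1) * l0 - l1 * (Z0 n w - l0)) / (Z0 n w * l0).
    by field; rewrite !gt_eqF.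
  rewrite normrM normfV (gtr0_norm (mulr_gt0 Z00 l00)) ler_pdivrMr ?mulr_gt0//.
  rewrite (le_trans (ler_normB _ _))// !normrM (gtr0_norm l00).
  apply: (@le_trans _ _ (eta * (l0 + `|l1|))).
    rewrite mulrDr; apply: lerD; first by rewrite ler_wpM2r// ltW.
    by rewrite mulrC ler_wpM2r.
  apply: (@le_trans _ _ (eps * (l0 / 2 * l0))).
    by move: etae; rewrite expr2; lra.
  by rewrite ler_wpM2l ?ler_wpM2r// ltW.
- exact: cvg_cst.
- by rewrite -[X in _ --> X]adde0; apply: cvgeD => //; [exact: Zl1|exact: Zl0].
Unshelve. all: by end_near. Qed.

Section Consistency.
Context (R : realType)
  (dT : measure_display) (T : measurableType dT) (P : probability T R)
  (X : int -> {RV P >-> R})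
  (dS : measure_display) (S : measurableType dS) (Q : probability S R)
  (Y : int -> {RV Q >-> R}) (alpha : R).
Hypothesis X_stationary : strictly_stationary X.
Hypothesis Y_tail : tail_process X Y alpha.
Context (delta : R) (delta_gt1 : 1 < delta).
Hypothesis X_mixing : alpha_mixing_bigO X delta.
Context (u : R^nat).
Hypothesis u_infty : u n @[n --> \oo] --> +oo.
Hypothesis u_rate :
  n%:R `^ (delta / (1 + delta)) * fine (P [set w | u n < X 0 w])
              @[n --> \oo] --> +oo.

Let p n := fine (P [set w | u n < X 0 w]).

Lemma scaled_setE k (x : R) (A : set 'rV[R]_k) : 0 < x ->
  [set x *: a | a in A] = [set v | A (x^-1 *: v)].
Proof.
move=> x0; apply/seteqP; split => [_ [a Aa <-]|v /= Av].
  by rewrite /= scalerA mulVf ?gt_eqF// scale1r.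
by exists (x^-1 *: v) => //; rewrite scalerA divff ?gt_eqF// scale1r.
Qed.

Lemma PhatE t n (x : R) (A : set 'rV[R]_t.+2) w : 0 < x ->
  Phat X n x A w = n%:R^-1 * \sum_(k < n - t)
    \1_[set v | A (x^-1 *: v)] (window X (k : nat)%:Z t.+2 w).
Proof.
move=> x0; rewrite /Phat scaled_setE//; congr (_ * _).
rewrite big_add1/= big_mkord; apply: eq_bigr => k _.
by have -> : (k : nat).+1%:Z - 1 = (k : nat)%:Z by rewrite -addn1 PoszD addrK.
Qed.

Lemma Phat_measurable t n (x : R) (A : set 'rV[R]_t.+2) : 0 < x -> borel A ->
  measurable_fun setT (Phat X n x A).
Proof.
move=> x0 bA.
rewrite (_ : Phat X n x A = fun w => n%:R^-1 * \sum_(k < n - t)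
    \1_[set v | A (x^-1 *: v)] (window X (k : nat)%:Z t.+2 w)); last first.
  by apply/funext => w; exact: PhatE.
apply: measurable_funM => //; apply: measurable_sum => k.
apply: (@measurable_indic _ _ _ setT
  (window X (k : nat)%:Z t.+2 @^-1` [set v | A (x^-1 *: v)])).
by apply: margin_preimage_measurable; exact: scaler_preimage_borel.
Qed.

Lemma Phat_ge0 t n (x : R) (A : set 'rV[R]_t.+2) w : 0 <= Phat X n x A w.
Proof. by rewrite mulr_ge0 ?invr_ge0// sumr_ge0// => i _; rewrite indicE. Qed.

(** On the nonnegative reals the inverse is the power of exponent -1, which is
    measurable. *)
Lemma Rhat_measurable c t n (x : R) (A A0 : set 'rV[R]_t.+2) : 0 < x ->
  borel A -> borel A0 -> measurable_fun setT (Rhat c X n x A A0).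
Proof.
move=> x0 bA bA0.
have mA := Phat_measurable n x0 bA; have mA0 := Phat_measurable n x0 bA0.
apply: measurable_fun_ifT => //; first exact: measurable_fun_eqr.
apply: measurable_funM => //.
rewrite (_ : (fun w => _) = (fun w => Phat X n x A0 w `^ (-1))).
  exact: (measurableT_comp (measurable_powR (-1)) mA0).
by apply/funext => w; rewrite powR_inv1// Phat_ge0.
Qed.

Lemma exceedance_prob_gt0 : \forall n \near \oo, 0 < p n.
Proof.
have /cvgryPgt/(_ 0) := u_rate.
move=> rate; near=> n; have : 0 < n%:R `^ (delta / (1 + delta)) * p n by near: n.
apply: contraTT; rewrite -!leNgt => pn.
by rewrite mulr_ge0_le0 ?powR_ge0.
Unshelve. all: by end_near. Qed.

(** In the proof, M n is the mean of Phat / p n. Its distance to the limit l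
    is eventually at most eps / 2, so that a deviation of Phat / p n by more
    than eps is a deviation of the count from its mean by at least eta = (eps
    / 2) n p n. *)
Lemma Phat_consistent t (A : set 'rV[R]_t.+2) :
  A `<=` exceedance_orthant R t ->
  continuity_set (law Q (window Y (-1) t.+2)) A ->
  cvg_in_probability P (fun n w => Phat X n (u n) A w / p n)
    (fine (law Q (window Y (-1) t.+2) A)).
Proof.
move=> Aorth cA eps eps0.
set l := fine _.
pose B n := [set v : 'rV[R]_t.+2 | A ((u n)^-1 *: v)].
have bB n : borel (B n) by apply: scaler_preimage_borel; case: cA.
pose a n := fine (P (window X 0 t.+2 @^-1` B n)).
have mB n k : measurable (window X k t.+2 @^-1` B n).
  exact: margin_preimage_measurable.
have u0 : \forall n \near \oo, 0 < u n by have /cvgryPgt/(_ 0) := u_infty.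
have ap : a n / p n @[n --> \oo] --> l.
  have := cvg_comp _ _ u_infty (tail_process_continuity_set Y_tail Aorth cA).
  apply: cvg_trans; apply: near_eq_cvg; near=> n => /=.
  rewrite /a /p; congr (fine _ / _).
  by rewrite (stationary_window X_stationary 0 (-1) (bB n)).
have a_le_p : \forall n \near \oo, a n <= p n.
  near=> n; have un : 0 < u n by near: n.
  rewrite /a /p (stationary_window X_stationary 0 (-1) (bB n)).
  have mX : measurable [set w | u n < X 0 w].
    by rewrite -[X in measurable X]setTI; exact: measurable_fun_ltr.
  apply: fine_le; rewrite ?fin_num_measure//.
  apply: le_measure; rewrite ?inE// => w /= /Aorth /(_ (inord 1)).
  rewrite inordK//= !mxE inordK//= addNr.
  by rewrite ltr_pdivlMl// mulr1.
pose M n := (n - t)%:R / n%:R * (a n / p n).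
have Ml : M n @[n --> \oo] --> l.
  rewrite -[l]mul1r; apply: cvgM => //.
  have inv0 : n%:R^-1 @[n --> \oo] --> (0 : R).
    by rewrite -(cvg_shiftS (fun n => n%:R^-1 : R)); exact: cvg_harmonic.
  have : 1 - t%:R * n%:R^-1 @[n --> \oo] --> (1 - t%:R * 0 : R).
    by apply: cvgB; [exact: cvg_cst|apply: cvgM; [exact: cvg_cst|]].
  rewrite mulr0 subr0; apply: cvg_trans; apply: near_eq_cvg; near=> n => /=.
  have tn : (t <= n)%N by near: n; exact: nbhs_infty_ge.
  have n0 : (0 < n)%N by near: n; exact: nbhs_infty_gt.
  by rewrite natrB// mulrBl divff// pnatr_eq0 -lt0n.
have mdist n : 0 < u n ->
    measurable [set w | eps < `|Phat X n (u n) A w / p n - l|].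
  move=> un; rewrite -[X in measurable X]setTI; apply: measurable_fun_ltr => //.
  apply: measurableT_comp => //; apply: measurable_funB => //.
  by apply: measurable_funM => //; apply: Phat_measurable => //; case: cA.
have [C [n0 _ mixC]] := X_mixing.
have mixC' h : (n0 <= h)%N ->
    (alpha_mixing X h <= (`|C| * h%:R `^ (- delta))%:E)%E.
  move=> /mixC /= /le_trans; apply.
  by rewrite lee_fin ler_wpM2r ?powR_ge0// ler_norm.
pose q n := n%:R `^ (delta / (1 + delta)) * p n.
have qV0 : (q n)^-1 @[n --> \oo] --> (0 : R).
  by apply/gtr0_cvgV0; [have /cvgryPgt/(_ 0) := u_rate|exact: u_rate].
pose K := `|C| / (delta - 1).
have K0 : 0 <= K by rewrite divr_ge0// subr_ge0 ltW.
pose bound n := 8 / eps ^+ 2 * ((2 + n0 + t.+2)%:R * (q n)^-1 + K * (q n)^-1 ^+ 2).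
have bound0 : bound n @[n --> \oo] --> (0 : R).
  rewrite (_ : 0 = 8 / eps ^+ 2 * ((2 + n0 + t.+2)%:R * 0 + K * (0 * 0))); last first.
    by rewrite !mulr0 addr0 mulr0.
  apply: cvgM; first exact: cvg_cst.
  apply: cvgD; apply: cvgM => //; [exact: cvg_cst..|].
  by under eq_fun do rewrite expr2; exact: cvgM.
apply/fine_cvgP; split.
  near=> n; have un : 0 < u n by near: n.
  exact/fin_num_measure/mdist.
apply: (@squeeze_cvgr _ _ _ _ (cst 0) bound) => //; last exact: cvg_cst.
near=> n; rewrite /= fine_ge0//=.
have un : 0 < u n by near: n.
have pn : 0 < p n by near: n; exact: exceedance_prob_gt0.
have n1 : (0 < n)%N by near: n; exact: nbhs_infty_gt.
have nR : 0 < n%:R :> R by rewrite ltr0n.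
have Mn : `|l - M n| <= eps / 2.
  by near: n; move/cvgrPdist_le : Ml; apply; rewrite divr_gt0.
have apn : a n <= p n by near: n.
pose eta := eps / 2 * n%:R * p n.
have eta0 : 0 < eta by rewrite !mulr_gt0.
have [m [n0m m0 mbound]] := block_length n0 t.+2 delta_gt1 K0 pn n1.
have := count_deviation X_stationary delta_gt1 (normr_ge0 C) mixC' (n - t)
  (bB n) apn n0m m0 eta0.
rewrite -/(a n) -/K.
set D' := [set w | eta <= _].
set D := [set w | eps < _].
move=> dev.
have mD' : measurable D'.
  rewrite -[D']setTI; apply: measurable_fun_ler => //.
  apply: measurableT_comp => //; apply: measurable_sum => k.
  by apply: measurable_funB => //; exact: (@measurable_indic _ _ _ setT
    (window X (k : nat)%:Z t.+2 @^-1` B n)).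
have mD : measurable D by exact: mdist.
have DD' : D `<=` D'.
  move=> w; rewrite /D /D' /= PhatE// => Dw.
  rewrite sumrB sumr_const card_ord -/(B n).
  set s := \sum_(k < n - t) _ in Dw *.
  have sE : s - a n *+ (n - t) = (n%:R^-1 * s / p n - M n) * (n%:R * p n).
    by rewrite /M -mulr_natr; field; rewrite !gt_eqF.
  rewrite sE normrM (gtr0_norm (mulr_gt0 nR pn)) /eta -mulrA ler_wpM2r ?mulr_ge0 ?ltW//.
  have := ler_distD (M n) (n%:R^-1 * s / p n) l; rewrite (distrC (M n)).
  by move: Dw Mn; lra.
have PD : fine (P D) <= fine (P D').
  by apply: fine_le; rewrite ?fin_num_measure//; apply: le_measure; rewrite ?inE.
apply: (le_trans PD).
rewrite -(ler_pM2l (exprn_gt0 2 eta0)); apply: (le_trans dev).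
apply: (@le_trans _ _ (2 * n%:R *
    (n%:R * p n ^+ 2 * ((2 + n0 + t.+2)%:R / q n + K / q n ^+ 2)))).
  apply: ler_pM => //.
    by apply: addr_ge0; apply: mulr_ge0 => //; exact: ltW.
  by rewrite ler_wpM2l// ler_nat leq_subr.
rewrite le_eqVlt; apply/orP; left; apply/eqP.
rewrite /bound /eta exprVn; set qs := _ + _; field.
by rewrite gt_eqF.
Unshelve. all: by end_near. Qed.

End Consistency.

Unset Implicit Arguments.

Theorem proposition4p1 (R : realType)
  (dT : measure_display) (T : measurableType dT) (P : probability T R)
  (X : int -> {RV P >-> R})
  (dS : measure_display) (S : measurableType dS) (Q : probability S R)
  (Y : int -> {RV Q >-> R})
  (alpha : R) (alpha_gt0 : 0 < alpha)
  (X_stationary : strictly_stationary X)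
  (X_endpoint : finite_lower_endpoint (X 0))
  (X_frechet : in_frechet_domain_of_attraction (X 0) alpha)
  (X_regvar : regularly_varying X alpha)
  (Y_tail : tail_process X Y alpha)
  (delta : R) (delta_gt1 : 1 < delta)
  (X_mixing : alpha_mixing_bigO X delta)
  (t : nat) (A0 A1 : set 'rV[R]_t.+2)
  (A0_sub : A0 `<=` exceedance_orthant R t)
  (A1_sub : A1 `<=` exceedance_orthant R t)
  (A0_cont : continuity_set (law Q (window Y (-1) t.+2)) A0)
  (A1_cont : continuity_set (law Q (window Y (-1) t.+2)) A1)
  (A0_gt0 : (0 < law Q (window Y (-1) t.+2) A0)%E)
  (u : R^nat)
  (u_infty : u n @[n --> \oo] --> +oo)
  (u_rate : n%:R `^ (delta / (1 + delta)) * fine (P [set w | u n < X 0 w])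
              @[n --> \oo] --> +oo)
  (c : R) :
  cvg_in_probability P (fun n => Rhat c X n (u n) A1 A0)
    (fine (law Q (window Y (-1) t.+2) A1) /
     fine (law Q (window Y (-1) t.+2) A0)).
Proof.
have l0 : 0 < fine (law Q (window Y (-1) t.+2) A0).
  apply: fine_gt0; rewrite A0_gt0/= (le_lt_trans _ (ltry 1))//.
  apply: probability_le1; apply: margin_preimage_measurable; by case: A0_cont.
apply: (cvg_in_probability_ratio l0 _
  (Phat_consistent X_stationary Y_tail delta_gt1 X_mixing u_infty u_rate
    A1_sub A1_cont)
  (Phat_consistent X_stationary Y_tail delta_gt1 X_mixing u_infty u_rate
    A0_sub A0_cont)).
near=> n.
have un : 0 < u n by near: n; have /cvgryPgt/(_ 0) := u_infty.
have pn : 0 < fine (P [set w | u n < X 0 w]).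
  near: n; exact: (exceedance_prob_gt0 (delta := delta)).
have bA1 : borel A1 by case: A1_cont.
have bA0 : borel A0 by case: A0_cont.
split.
- by apply: measurable_funM => //; exact: Phat_measurable.
- by apply: measurable_funM => //; exact: Phat_measurable.
- exact: Rhat_measurable.
- move=> w; rewrite mulf_eq0 invr_eq0 (gt_eqF pn) orbF => Pn.
  rewrite /Rhat (negbTE Pn); field; rewrite Pn gt_eqF//.
Unshelve. all: by end_near. Qed.
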